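(* For $\gamma>0$, $\alpha^2>0$, an integer $k\ge1$ and $\gamma_1,\dots,\gamma_k>0$ with $\sum_{i=1}^k1/\gamma_i=1/\gamma$, let $$ARE=\frac{\gamma m_\gamma(-\gamma/\alpha^2)}{\alpha^2}\left[1+\sum_{i=1}^k\left(\frac{\alpha^2}{\gamma_im_{\gamma_i}(-\gamma_i/\alpha^2)}-1\right)\right]$$ be the asymptotic relative efficiency of optimally weighted and optimally tuned distributed ridge regression compared to optimally tuned centralized ridge regression (identity covariance). Then: 1. (Worst case is equally distributed data.) For fixed $k,\alpha^2,\gamma$, the ARE attains its minimum over $(\gamma_1,\dots,\gamma_k)$ when $\gamma_1=\gamma_2=\cdots=\gamma_k=k\gamma$, and $$\min_{\gamma_1,\dots,\gamma_k}ARE=\psi(k,\gamma,\alpha^2):=\frac{\gamma m_\gamma(-\gamma/\alpha^2)}{\alpha^2}\left(1-k+\frac{\alpha^2}{\gamma m_{k\gamma}(-k\gamma/\alpha^2)}\right).$$ 2. (Adding more machines leads to efficiency loss.) For fixed $\alpha^2$ and $\gamma$, $\psi(k,\gamma,\alpha^2)$, viewed as a function of real $k$ by the same formula, is a decreasing function of $k\in[1,\infty)$ with $\lim_{k\to1_+}\psi(k,\gamma,\alpha^2)=1$ and $$\lim_{k\to\infty}\psi(k,\gamma,\alpha^2)=h(\alpha^2,\gamma)<1,$$ and this limit is strictly positive. 3. (Form of the infinite-worker limit.) $$h(\alpha^2,\gamma)=\frac{-\gamma/\alpha^2+\gamma-1+\sqrt{(-\gamma/\alpha^2+\gamma-1)^2+4\gamma^2/\alpha^2}}{2\gamma}\left(1+\frac{\alpha^2}{\gamma(1+\alpha^2)}\right).$$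 4. (Edge cases.) For fixed $\alpha^2$, $h(\alpha^2,\gamma)$ is an increasing function of $\gamma\in[0,\infty)$ with $$\lim_{\gamma\to0}h(\alpha^2,\gamma)=\frac1{1+\alpha^2},\qquad\lim_{\gamma\to\infty}h(\alpha^2,\gamma)=1.$$ For fixed $\gamma$, $h(\alpha^2,\gamma)$ is a decreasing function of $\alpha^2\in[0,\infty)$ with $$\lim_{\alpha^2\to0}h(\alpha^2,\gamma)=1,\qquad\lim_{\alpha^2\to\infty}h(\alpha^2,\gamma)=\begin{cases}1-\frac1{\gamma^2},&\gamma>1,\\0,&0<\gamma\le1.\end{cases}$$
   Context: $m_\gamma$ is the Stieltjes transform of the Marchenko–Pastur law with identity covariance, $$m_\gamma(z)=\frac{(z+\gamma-1)+\sqrt{(z+\gamma-1)^2-4z\gamma}}{-2z\gamma}$$ (principal branch of the square root), so that $$\gamma m_\gamma(-\gamma/\alpha^2)=\frac{-\gamma/\alpha^2+\gamma-1+\sqrt{(-\gamma/\alpha^2+\gamma-1)^2+4\gamma^2/\alpha^2}}{2\gamma/\alpha^2}.$$ Background: data with $p/n\to\gamma$ are distributed over $k$ machines with local sample sizes $n_i$, $\sum_i n_i=n$, $p/n_i\to\gamma_i$ (hence $\sum_i1/\gamma_i=1/\gamma$). The limiting risk of optimally weighted distributed ridge with tuning $\lambda_i=\gamma_i/\alpha^2$ is $\mathcal M_k=\sigma^2\alpha^2/\bigl(1+\sum_{i=1}^k[\alpha^2/(\gamma_im_{\gamma_i}(-\gamma_i/\alpha^2))-1]\bigr)$, that of optimally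 tuned centralized ridge is $\mathcal M_1=\sigma^2\gamma m_\gamma(-\gamma/\alpha^2)$, and $ARE=\mathcal M_1/\mathcal M_k$. Here $\sigma^2>0$ is the noise variance and $\alpha^2$ the signal-to-noise ratio. Values of $h$ at the endpoint $0$ of $[0,\infty)$ are understood as the corresponding limits. *)

(* Defs.v *)
From HB Require Import structures.
From mathcomp Require Import all_boot all_order all_algebra.
From mathcomp Require Import boolp classical_sets reals topology normedtype.

Set Implicit Arguments.
Unset Strict Implicit.
Unset Printing Implicit Defensive.

Import Order.TTheory GRing.Theory Num.Theory.
Import numFieldNormedType.Exports.

Local Open Scope classical_set_scope.
Local Open Scope ring_scope.

(* Throughout, alpha2 and sigma2 stand for the parameters alpha^2 and sigma^2. *)

Section DistributedRidge.
Context {R : realType}.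

(* Stieltjes transform of the Marchenko-Pastur law, restricted to real z < 0,
   where (z + gamma - 1)^2 - 4 z gamma > 0 for gamma > 0, so that the principal
   branch of the square root is the real one. *)
Definition mp_stieltjes (gamma z : R) : R :=
  ((z + gamma - 1) + Num.sqrt ((z + gamma - 1) ^+ 2 - 4 * z * gamma))
    / (- 2 * z * gamma).

Definition ARE (k : nat) (gammas : 'I_k -> R) (gamma alpha2 : R) : R :=
  gamma * mp_stieltjes gamma (- gamma / alpha2) / alpha2 *
  (1 + \sum_(i < k)
         (alpha2 / (gammas i * mp_stieltjes (gammas i) (- gammas i / alpha2))
          - 1)).

Definition risk_centralized (sigma2 gamma alpha2 : R) : R :=
  sigma2 * (gamma * mp_stieltjes gamma (- gamma / alpha2)).

Definition risk_distributed (sigma2 : R) (k : nat) (gammas : 'I_k -> R)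
    (alpha2 : R) : R :=
  sigma2 * alpha2 /
  (1 + \sum_(i < k)
         (alpha2 / (gammas i * mp_stieltjes (gammas i) (- gammas i / alpha2))
          - 1)).

Lemma ARE_risk_ratio (sigma2 : R) (k : nat) (gammas : 'I_k -> R)
    (gamma alpha2 : R) :
  0 < sigma2 ->
  ARE gammas gamma alpha2 =
  risk_centralized sigma2 gamma alpha2 / risk_distributed sigma2 gammas alpha2.
Proof.
move=> s0; rewrite /ARE /risk_centralized /risk_distributed invf_div.
move: (1 + _) (gamma * _) => S m.
by rewrite mulrA -[sigma2 * m * S]mulrA -mulf_div mulfV ?gt_eqF // mul1r mulrAC.
Qed.

(* The local aspect ratios gamma_i achievable with k machines. *)
Definition admissible (k : nat) (gammas : 'I_k -> R) (gamma : R) : Prop :=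
  (forall i, 0 < gammas i) /\ \sum_(i < k) (gammas i)^-1 = gamma^-1.

(* The number of machines k is a real variable here. *)
Definition psi (k gamma alpha2 : R) : R :=
  gamma * mp_stieltjes gamma (- gamma / alpha2) / alpha2 *
  (1 - k + alpha2 /
     (gamma * mp_stieltjes (k * gamma) (- (k * gamma) / alpha2))).

Definition h (alpha2 gamma : R) : R := lim (psi k gamma alpha2 @[k --> +oo]).

(* h as a function of one parameter on [0, +oo[, with the value at the endpoint
   0 given by the limit from the right. *)
Definition h_of_gamma (alpha2 : R) : R -> R := fun gamma =>
  if gamma == 0 then lim (h alpha2 g @[g --> 0^'+]) else h alpha2 gamma.

Definition h_of_alpha2 (gamma : R) : R -> R := fun alpha2 =>
  if alpha2 == 0 then lim (h a gamma @[a --> 0^'+]) else h alpha2 gamma.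

End DistributedRidge.

(* Main.v *)
(** Put u = 1/gamma and F(u) = alpha^2 / (gamma m_gamma(-gamma/alpha^2)). The
    quadratic equation for m_gamma becomes a u F = (F - 1)(F + a), a = alpha^2,
    so F(0) = 1 and F is increasing and convex, and
    ARE = (1 + sum_i (F(u_i) - 1)) / F(u) with sum_i u_i = u: Jensen's
    inequality yields part 1. With f = F(u/k) the equation also gives
    k (f - 1) = a u (1 - a / (f + a)), which is monotone in k and tends to
    a u / (1 + a). Finally, q = 1 - 1/F(u) in (0, min(u, 1)) satisfies
    q = a (u - q)(1 - q) and h = 1 - a / (1 + a) q^2, from which the monotonicity
    and the limits of h are read off. *)
Require Import Defs.
From HB Require Import structures.
From mathcomp Require Import all_boot all_order all_algebra.
From mathcomp Require Import boolp classical_sets reals topology normedtype realfun.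
From mathcomp Require Import ring lra.

Set Implicit Arguments.
Unset Strict Implicit.
Unset Printing Implicit Defensive.

Import Order.TTheory GRing.Theory Num.Theory.
Import numFieldNormedType.Exports.

Local Open Scope classical_set_scope.
Local Open Scope ring_scope.

(** * The function F: quadratic equation, monotonicity, convexity *)

(** The positive root f of f^2 = (1 - a + a u) f + a, the F(u) of the overview. As a function of
    every real u it also covers u = 0, the limit of infinitely many machines. *)
Definition inv_risk (R : realType) (a u : R) : R :=
  (1 - a + a * u + Num.sqrt ((1 - a + a * u) ^+ 2 + 4 * a)) / 2.

(** The q of the overview. At u = 1/gamma, it is the relative amount by which the centralized risk
    falls below sigma^2 alpha^2. *)
Definition risk_gap (R : realType) (a u : R) : R := 1 - (inv_risk a u)^-1.

Lemma inv_risk_gt0 (R : realType) (a u : R) : 0 < a -> 0 < inv_risk a u.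
Proof.
move=> a0; rewrite divr_gt0 //; set v := 1 - a + a * u.
suff : - v < Num.sqrt (v ^+ 2 + 4 * a) by lra.
apply: (le_lt_trans (ler_norm _)); rewrite normrN -sqrtr_sqr ltr_sqrt; first lra.
by have := sqr_ge0 v; lra.
Qed.

Lemma inv_risk_sqr (R : realType) (a u : R) : 0 < a ->
  inv_risk a u ^+ 2 = (1 - a + a * u) * inv_risk a u + a.
Proof.
move=> a0; rewrite /inv_risk; set v := 1 - a + a * u.
have : Num.sqrt (v ^+ 2 + 4 * a) ^+ 2 = v ^+ 2 + 4 * a.
  by rewrite sqr_sqrtr //; have := sqr_ge0 v; lra.
by move: (Num.sqrt _) => s; lra.
Qed.

Lemma inv_risk_factor (R : realType) (a u : R) : 0 < a ->
  a * u * inv_risk a u = (inv_risk a u - 1) * (inv_risk a u + a).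
Proof. by move=> a0; have := inv_risk_sqr u a0; lra. Qed.

Lemma inv_risk0 (R : realType) (a : R) : 0 < a -> inv_risk a 0 = 1.
Proof.
move=> a0; have /eqP := inv_risk_factor 0 a0.
rewrite mulr0 mul0r eq_sym mulf_eq0 => /orP[] /eqP e; first by lra.
by have := inv_risk_gt0 0 a0; lra.
Qed.

Lemma inv_risk_lt (R : realType) (a u1 u2 : R) : 0 < a -> u1 < u2 ->
  inv_risk a u1 < inv_risk a u2.
Proof.
move=> a0 u12; have := inv_risk_sqr u1 a0; have := inv_risk_sqr u2 a0.
have := inv_risk_gt0 u1 a0; have := inv_risk_gt0 u2 a0.
move: (inv_risk a u1) (inv_risk a u2) => f1 f2 f20 f10 e2 e1.
(* f1 times the quadratic equation of f2, minus f2 times that of f1: the signs of f2 - f1 and u2 -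
   u1 agree. *)
have e : (f2 - f1) * (f1 * f2 + a) = a * (u2 - u1) * (f1 * f2).
  transitivity (f2 ^+ 2 * f1 - f1 ^+ 2 * f2 + a * (f2 - f1)); first by ring.
  by rewrite e1 e2; ring.
have f12 : 0 < f1 * f2 by rewrite mulr_gt0.
rewrite -subr_gt0 -(pmulr_lgt0 _ (addr_gt0 f12 a0)) e.
by rewrite !mulr_gt0 // subr_gt0.
Qed.

Lemma inv_risk_gt1 (R : realType) (a u : R) : 0 < a -> 0 < u ->
  1 < inv_risk a u.
Proof. by move=> a0 u0; rewrite -(inv_risk0 a0) inv_risk_lt. Qed.

(** The quadratic equation is linear in u, so F has an explicit rational inverse; later identities
    eliminate u with it and stay free of square roots. *)
Lemma inv_riskK (R : realType) (a u : R) : 0 < a ->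
  a * u = inv_risk a u - 1 + a - a / inv_risk a u.
Proof.
move=> a0; have f0 := inv_risk_gt0 u a0.
apply: (mulIf (lt0r_neq0 f0)); rewrite [RHS]mulrBl divfK ?gt_eqF //.
by rewrite inv_risk_factor //; ring.
Qed.

(* The tangent line of [inv_risk a] at [u0] lies below its graph: the inverse
   function [f |-> (f - 1 + a - a / f) / a] is concave. *)
Lemma inv_risk_tangent (R : realType) (a u0 u : R) : 0 < a ->
  inv_risk a u0 + a / (1 + a / inv_risk a u0 ^+ 2) * (u - u0) <= inv_risk a u.
Proof.
move=> a0; have := inv_riskK u0 a0; have := inv_riskK u a0.
have := inv_risk_gt0 u0 a0; have := inv_risk_gt0 u a0.
move: (inv_risk a u0) (inv_risk a u) => f0 f fp f0p e e0.
have d0 : 0 < 1 + a / f0 ^+ 2 by rewrite addr_gt0 // divr_gt0 // exprn_gt0.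
rewrite -lerBrDl mulrAC ler_pdivrMr // mulrBr e e0 -subr_ge0.
(* The tangent of the inverse function at f0 exceeds it by an explicit nonnegative multiple of (f -
   f0)^2. *)
have -> : (f - f0) * (1 + a / f0 ^+ 2) -
    (f - 1 + a - a / f - (f0 - 1 + a - a / f0)) =
  a * (f - f0) ^+ 2 / (f * f0 ^+ 2) by field; rewrite !gt_eqF.
by rewrite divr_ge0 // mulr_ge0 ?sqr_ge0 // ltW.
Qed.

Lemma inv_risk_continuous (R : realType) (a : R) : continuous (inv_risk a).
Proof.
move=> u; have v : 1 - a + a * u' @[u' --> u] --> 1 - a + a * u.
  by apply: cvgD; [exact: cvg_cst|apply: cvgM; [exact: cvg_cst|exact: cvg_id]].
apply: cvgM; [apply: cvgD => //|exact: cvg_cst].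
have v2 : (1 - a + a * u') ^+ 2 + 4 * a @[u' --> u] -->
    (1 - a + a * u) ^+ 2 + 4 * a.
  apply: cvgD; [|exact: cvg_cst].
  exact: (cvg_comp _ _ v (@exprn_continuous _ _ _)).
exact: (cvg_comp _ _ v2 (@sqrt_continuous R _)).
Qed.

(** * From the Stieltjes transform to F; limits of psi *)

(** The two discriminants differ by the factor (g / a)^2, so both sides contain the same root s; the
    claim reduces to the conjugate product (s - v)(s + v) / 4 = a. *)
Lemma mp_stieltjes_inv_risk (R : realType) (g a : R) : 0 < g -> 0 < a ->
  g * mp_stieltjes g (- g / a) = a / inv_risk a g^-1.
Proof.
move=> g0 a0; have := inv_risk_gt0 g^-1 a0; have := inv_risk_sqr g^-1 a0.
rewrite /mp_stieltjes /inv_risk; set v := 1 - a + a / g.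
have -> : (- g / a + g - 1) ^+ 2 - 4 * (- g / a) * g =
    (g / a) ^+ 2 * (v ^+ 2 + 4 * a) by rewrite /v; field; rewrite !gt_eqF.
rewrite sqrtrM ?sqr_ge0 // sqrtr_sqr gtr0_norm; last exact: divr_gt0.
move: (Num.sqrt _) => s.
have -> : - g / a + g - 1 = - (g / a) * v by rewrite /v; field; rewrite !gt_eqF.
move=> e p; apply: (mulIf (lt0r_neq0 p)); rewrite divfK ?gt_eqF //.
transitivity ((s - v) * (v + s) / 4); last by lra.
by field; rewrite !gt_eqF.
Qed.

Lemma psi_inv_risk (R : realType) (k g a : R) : 0 < k -> 0 < g -> 0 < a ->
  psi k g a = (1 + k * (inv_risk a (k * g)^-1 - 1)) / inv_risk a g^-1.
Proof.
move=> k0 g0 a0; rewrite /psi mp_stieltjes_inv_risk //.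
have f0 := inv_risk_gt0 (k * g)^-1 a0.
have -> : g * mp_stieltjes (k * g) (- (k * g) / a) =
    a / inv_risk a (k * g)^-1 / k.
  by rewrite -mp_stieltjes_inv_risk ?mulr_gt0 //; field; rewrite !gt_eqF.
by field; rewrite !gt_eqF // inv_risk_gt0.
Qed.

(** As k grows, k (F - 1) is an indeterminate product. The factored quadratic equation removes the
    outer k, which then enters only through F(1/(k g)). *)
Lemma psi_fraction (R : realType) (k g a : R) : 0 < k -> 0 < g -> 0 < a ->
  psi k g a = (1 + a / g * (1 - a / (inv_risk a (k * g)^-1 + a)))
              / inv_risk a g^-1.
Proof.
move=> k0 g0 a0; rewrite psi_inv_risk //; congr ((1 + _) / _).
have := inv_risk_factor (k * g)^-1 a0; have := inv_risk_gt0 (k * g)^-1 a0.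
move: (inv_risk _ _) => f f0 e.
have fa0 : 0 < f + a by rewrite addr_gt0.
apply: (mulIf (lt0r_neq0 fa0)); rewrite -[LHS]mulrA -e.
by field; rewrite !gt_eqF.
Qed.

(** A general filter covers both limits: u0 = 1/g for k to 1, and u0 = 0 for k to infinity. *)
Lemma psi_cvg (R : realType) (F : set_system R) (FF : Filter F) (u0 g a : R) :
  0 < g -> 0 < a -> (\forall k \near F, 0 < k) ->
  (k * g)^-1 @[k --> F] --> u0 ->
  psi k g a @[k --> F] -->
    (1 + a / g * (1 - a / (inv_risk a u0 + a))) / inv_risk a g^-1.
Proof.
move=> g0 a0 k0 ku.
apply: (@cvg_trans _ ((1 + a / g * (1 - a / (inv_risk a (k * g)^-1 + a)))
              / inv_risk a g^-1 @[k --> F])).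
  by apply: near_eq_cvg; near=> k; rewrite psi_fraction //; near: k.
apply: cvgM; [apply: cvgD; [exact: cvg_cst|]|exact: cvg_cst].
apply: cvgM; [exact: cvg_cst|apply: cvgB; [exact: cvg_cst|]].
apply: cvgM; [exact: cvg_cst|apply: cvgV].
  by rewrite gt_eqF // addr_gt0 // inv_risk_gt0.
apply: cvgD; [|exact: cvg_cst].
exact: (cvg_comp _ _ ku (@inv_risk_continuous R a _)).
Unshelve. all: by end_near. Qed.

Lemma invr_cvg_pinfty (R : realType) : x^-1 @[x --> +oo] --> (0 : R).
Proof.
apply/gtr0_cvgV0; last exact: cvg_id.
by apply: nbhs_pinfty_gt; rewrite num_real.
Qed.

Lemma psi_cvg_pinfty (R : realType) (g a : R) : 0 < g -> 0 < a ->
  psi k g a @[k --> +oo] --> (1 + a / g * (1 - a / (1 + a))) / inv_risk a g^-1.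
Proof.
move=> g0 a0; rewrite -{3}(inv_risk0 a0); apply: psi_cvg => //.
  by apply: nbhs_pinfty_gt; rewrite num_real.
under eq_fun do rewrite invfM.
rewrite -(mul0r g^-1).
by apply: cvgM; [exact: invr_cvg_pinfty|exact: cvg_cst].
Qed.

(** * The gap q: equation, bounds, monotonicity *)

Lemma risk_gap_eq (R : realType) (a u : R) : 0 < a ->
  risk_gap a u = a * (u - risk_gap a u) * (1 - risk_gap a u).
Proof.
move=> a0; have f0 := inv_risk_gt0 u a0; rewrite /risk_gap.
rewrite [a * (u - _)]mulrBr (inv_riskK u) //; by field; rewrite gt_eqF.
Qed.

Lemma risk_gap_lt1 (R : realType) (a u : R) : 0 < a -> risk_gap a u < 1.
Proof. by move=> a0; rewrite ltrBlDr ltrDl invr_gt0 inv_risk_gt0. Qed.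

Lemma risk_gap_gt0 (R : realType) (a u : R) : 0 < a -> 0 < u ->
  0 < risk_gap a u.
Proof.
by move=> a0 u0; rewrite subr_gt0 invf_lt1 ?inv_risk_gt0 ?inv_risk_gt1.
Qed.

(** In q = a (u - q)(1 - q) the left side and 1 - q are positive, hence so is u - q. *)
Lemma risk_gap_lt_ratio (R : realType) (a u : R) : 0 < a -> 0 < u ->
  risk_gap a u < u.
Proof.
move=> a0 u0; have := risk_gap_gt0 a0 u0; rewrite {1}risk_gap_eq //.
by rewrite pmulr_lgt0 ?subr_gt0 ?risk_gap_lt1 // pmulr_rgt0 // subr_gt0.
Qed.

Lemma risk_gap_lt (R : realType) (a u1 u2 : R) : 0 < a -> u1 < u2 ->
  risk_gap a u1 < risk_gap a u2.
Proof.
move=> a0 u12; rewrite ltrD2l ltrN2 ltf_pV2 ?posrE ?inv_risk_gt0 //.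
exact: inv_risk_lt.
Qed.

(** The product (u - q)(1 - q) decreases in q below min(u, 1). If q2 <= q1, it would be no smaller
    at q2, and the larger factor a2 would force q1 < q2. *)
Lemma risk_gap_lt_snr (R : realType) (a1 a2 u : R) : 0 < u -> 0 < a1 ->
  a1 < a2 -> risk_gap a1 u < risk_gap a2 u.
Proof.
move=> u0 a10 a12; have a20 := lt_trans a10 a12.
have := risk_gap_eq u a10; have := risk_gap_eq u a20.
have := risk_gap_lt1 u a10; have := risk_gap_lt_ratio a10 u0.
have := risk_gap_lt1 u a20; have := risk_gap_lt_ratio a20 u0.
move: (risk_gap a1 u) (risk_gap a2 u) => q1 q2 q2u q21 q1u q11 e2 e1.
rewrite ltNge; apply/negP => q21'.
have le12 : (u - q1) * (1 - q1) <= (u - q2) * (1 - q2).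
  by apply: ler_pM; lra.
have gt01 : 0 < (u - q1) * (1 - q1) by apply: mulr_gt0; lra.
suff : q1 < q2 by rewrite ltNge q21'.
rewrite e1 e2 -!mulrA.
by apply: (@lt_le_trans _ _ (a2 * ((u - q1) * (1 - q1))));
  rewrite ?ltr_pM2r ?ler_pM2l.
Qed.

(** * The limit h in terms of q; monotonicity of h *)

(** Eliminating u by [inv_riskK] leaves (1 + 2 a / F - a / F^2) / (1 + a); completing the square in
    1/F gives the formula. *)
Lemma h_risk_gap (R : realType) (g a : R) : 0 < g -> 0 < a ->
  h a g = 1 - a / (1 + a) * risk_gap a g^-1 ^+ 2.
Proof.
move=> g0 a0; rewrite /h (cvg_lim _ (psi_cvg_pinfty g0 a0)) //.
rewrite /risk_gap (inv_riskK g^-1) //; have := inv_risk_gt0 g^-1 a0 => f0.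
by field; rewrite !gt_eqF // addr_gt0.
Qed.

Lemma h_lt1 (R : realType) (g a : R) : 0 < g -> 0 < a -> h a g < 1.
Proof.
move=> g0 a0; rewrite h_risk_gap // gtrBl.
by rewrite mulr_gt0 ?exprn_gt0 ?risk_gap_gt0 ?invr_gt0 // divr_gt0 // addr_gt0.
Qed.

(** This is q < 1. It yields both the positivity of h and strict monotonicity from the endpoint
    gamma = 0. *)
Lemma h_gt_endpoint (R : realType) (g a : R) : 0 < g -> 0 < a ->
  1 / (1 + a) < h a g.
Proof.
move=> g0 a0; rewrite h_risk_gap //.
have q0 : 0 < risk_gap a g^-1 by rewrite risk_gap_gt0 ?invr_gt0.
have q1 := risk_gap_lt1 g^-1 a0.
have -> : 1 / (1 + a) = 1 - a / (1 + a) * 1.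
  by field; rewrite gt_eqF // addr_gt0.
rewrite ltrD2l ltrN2 ltr_pM2l ?divr_gt0 ?addr_gt0 //.
by rewrite expr_lt1 // ltW.
Qed.

Lemma h_lt_gamma (R : realType) (a g1 g2 : R) : 0 < a -> 0 < g1 -> g1 < g2 ->
  h a g1 < h a g2.
Proof.
move=> a0 g10 g12; have g20 := lt_trans g10 g12; rewrite !h_risk_gap //.
rewrite ltrD2l ltrN2 ltr_pM2l ?divr_gt0 ?addr_gt0 //.
rewrite ltr_pXn2r ?nnegrE ?ltW ?risk_gap_gt0 ?invr_gt0 //.
by rewrite risk_gap_lt // ltf_pV2.
Qed.

Lemma h_lt_alpha2 (R : realType) (g a1 a2 : R) : 0 < g -> 0 < a1 -> a1 < a2 ->
  h a2 g < h a1 g.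
Proof.
move=> g0 a10 a12; have a20 := lt_trans a10 a12; rewrite !h_risk_gap //.
have u0 : 0 < g^-1 by rewrite invr_gt0.
rewrite ltrD2l ltrN2; apply: ltr_pM.
- by rewrite divr_ge0 ?ltW ?addr_gt0.
- exact: sqr_ge0.
- rewrite ltr_pdivrMr ?addr_gt0 // mulrAC ltr_pdivlMr ?addr_gt0 //; lra.
- by rewrite ltr_pXn2r ?nnegrE ?ltW ?risk_gap_gt0 ?risk_gap_lt_snr.
Qed.

(** * Edge cases: limits of h *)

(** For g < 1/2, the equation g q = a (1 - g q)(1 - q) with 1 - g q >= 1/2 gives 1 - q <= 2 g / a.
    Then 1 - q^2 <= 2 (1 - q) accounts for the constant 4. *)
Lemma h_cvg_gamma0 (R : realType) (a : R) : 0 < a ->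
  h a g @[g --> 0^'+] --> 1 / (1 + a).
Proof.
move=> a0.
apply: (@squeeze_cvgr _ _ _ _ (fun=> 1 / (1 + a))
   (fun g => 1 / (1 + a) + 4 * (g / a))); first last.
- rewrite [X in _ --> X](_ : _ = 1 / (1 + a) + 4 * (0 / a)); last first.
    by rewrite mul0r mulr0 addr0.
  apply: cvgD; [exact: cvg_cst|apply: cvgM; [exact: cvg_cst|]].
  apply: cvgM; [|exact: cvg_cst].
  exact: (@cvg_at_right_filter _ _ id).
- exact: cvg_cst.
near=> g.
have g0 : 0 < g by near: g; exact: nbhs_right_gt.
have g12 : g < 1 / 2 by near: g; apply: nbhs_right_lt; lra.
rewrite ltW ?h_gt_endpoint //= h_risk_gap //.
have u0 : 0 < g^-1 by rewrite invr_gt0.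
have := risk_gap_gt0 a0 u0; have := risk_gap_lt1 g^-1 a0.
have := risk_gap_eq g^-1 a0; move: (risk_gap _ _) => q e q1 q0.
have c0 : 0 < a / (1 + a) by rewrite divr_gt0 // addr_gt0.
have c1 : a / (1 + a) < 1 by rewrite ltr_pdivrMr ?addr_gt0 //; lra.
have -> : 1 / (1 + a) = 1 - a / (1 + a).
  by field; rewrite gt_eqF // addr_gt0.
have gu : g * g^-1 = 1 by rewrite divff // gt_eqF.
have ga : 1 - q <= 2 * (g / a).
  rewrite mulrA ler_pdivlMr //.
  have : (g * g^-1 - g * q) * a * (1 - q) = g * q.
    by rewrite {3}e; ring.
  rewrite gu => e'; have gq : 1 / 2 <= 1 - g * q by nra.
  have p : 0 < (1 - q) * a by rewrite mulr_gt0 // subr_gt0.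
  have : g * q <= g by nra.
  move: e'; rewrite -mulrA [a * _]mulrC.
  move: ((1 - q) * a) (g * q) p gq => x y x0 y1 xy yg.
  have : 0 <= (1 - y - 1 / 2) * x by apply: mulr_ge0; lra.
  by rewrite mulrBl xy; lra.
move: (g / a) (a / (1 + a)) ga c0 c1 => x c ga c0 c1.
have q2 : 1 - q ^+ 2 <= 2 * (1 - q) by nra.
have : c * (1 - q ^+ 2) <= 1 - q ^+ 2 by rewrite ler_piMl ?ltW //; nra.
by lra.
Unshelve. all: by end_near. Qed.

Lemma h_cvg_gamma_pinfty (R : realType) (a : R) : 0 < a ->
  h a g @[g --> +oo] --> (1 : R).
Proof.
move=> a0.
(* 1 - h <= q^2 <= q < 1/g. *)
apply: (@squeeze_cvgr _ _ _ _ (fun g => 1 - g^-1) (fun=> 1)); first last.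
- exact: cvg_cst.
- rewrite -[X in _ --> X](subr0 1).
  by apply: cvgB; [exact: cvg_cst|exact: invr_cvg_pinfty].
near=> g.
have g1 : 1 < g by near: g; apply: nbhs_pinfty_gt; rewrite num_real.
have g0 : 0 < g by lra.
rewrite (ltW (h_lt1 _ _)) // andbT h_risk_gap //.
have u0 : 0 < g^-1 by rewrite invr_gt0.
have := risk_gap_gt0 a0 u0; have := risk_gap_lt1 g^-1 a0.
have := risk_gap_lt_ratio a0 u0; move: (risk_gap _ _) => q qu q1 q0.
have c0 : 0 < a / (1 + a) by rewrite divr_gt0 // addr_gt0.
have c1 : a / (1 + a) < 1 by rewrite ltr_pdivrMr ?addr_gt0 //; lra.
by move: (a / _) c0 c1 => c; nra.
Unshelve. all: by end_near. Qed.

Lemma h_cvg_alpha20 (R : realType) (g : R) : 0 < g ->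
  h a g @[a --> 0^'+] --> (1 : R).
Proof.
move=> g0.
(* 1 - h <= a / (1 + a) <= a, since 0 < q < 1. *)
apply: (@squeeze_cvgr _ _ _ _ (fun a => 1 - a) (fun=> 1)); first last.
- exact: cvg_cst.
- rewrite -[X in _ --> X](subr0 1).
  by apply: cvgB; [exact: cvg_cst|exact: (@cvg_at_right_filter _ _ id)].
near=> a.
have a0 : 0 < a by near: a; exact: nbhs_right_gt.
rewrite (ltW (h_lt1 _ _)) // andbT h_risk_gap //.
have u0 : 0 < g^-1 by rewrite invr_gt0.
have := risk_gap_gt0 a0 u0; have := risk_gap_lt1 g^-1 a0.
move: (risk_gap _ _) => q q1 q0.
have c0 : 0 < a / (1 + a) by rewrite divr_gt0 // addr_gt0.
have ca : a / (1 + a) <= a by rewrite ler_pdivrMr ?addr_gt0 //; nra.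
move: (a / _) c0 ca => c c0 ca.
have : c * q ^+ 2 <= c by rewrite ler_piMr ?exprn_ile1 ?ltW.
by lra.
Unshelve. all: by end_near. Qed.

(* With m = min(1/g, 1) the equation for the gap q gives
   (m - q)^2 <= (1/g - q)(1 - q) = q / a <= 1 / a. *)
Lemma h_cvg_alpha2_pinfty (R : realType) (g : R) : 0 < g ->
  h a g @[a --> +oo] --> 1 - Num.min g^-1 1 ^+ 2.
Proof.
move=> g0; have u0 : 0 < g^-1 by rewrite invr_gt0.
set m := Num.min g^-1 1.
have mu : m <= g^-1 by rewrite ge_min lexx.
have m1 : m <= 1 by rewrite ge_min lexx orbT.
apply: (@squeeze_cvgr _ _ _ _ (fun=> 1 - m ^+ 2)
  (fun a => 1 - m ^+ 2 + (2 * Num.sqrt a^-1 + a^-1))); first last.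
- rewrite [X in _ --> X](_ : _ = 1 - m ^+ 2 + (2 * 0 + 0)); last first.
    by rewrite mulr0 !addr0.
  apply: cvgD; [exact: cvg_cst|apply: cvgD; last exact: invr_cvg_pinfty].
  apply: cvgM; [exact: cvg_cst|rewrite -(sqrtr0 R)].
  exact: (cvg_comp _ _ (@invr_cvg_pinfty R) (@sqrt_continuous R _)).
- exact: cvg_cst.
near=> a.
have a0 : 0 < a by near: a; apply: nbhs_pinfty_gt; rewrite num_real.
rewrite h_risk_gap //.
have := risk_gap_gt0 a0 u0; have := risk_gap_lt1 g^-1 a0.
have := risk_gap_lt_ratio a0 u0; have := risk_gap_eq g^-1 a0.
move: (risk_gap _ _) => q e qu q1 q0.
have qm : q < m by rewrite lt_min qu q1.
have b0 : 0 < a^-1 by rewrite invr_gt0.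
have c1 : 1 - a^-1 <= a / (1 + a).
  rewrite ler_pdivlMr ?addr_gt0 // mulrBl mul1r mulrDr mulr1 mulVf ?gt_eqF //.
  by lra.
have c2 : a / (1 + a) < 1 by rewrite ltr_pdivrMr ?addr_gt0 //; lra.
have c0 : 0 < a / (1 + a) by rewrite divr_gt0 // addr_gt0.
have mq : m - q <= Num.sqrt a^-1.
  have mq0 : 0 <= m - q by lra.
  rewrite -(ger0_norm mq0) -sqrtr_sqr ler_wsqrtr //.
  rewrite -[a^-1]mul1r ler_pdivlMr //.
  have : (m - q) ^+ 2 <= (g^-1 - q) * (1 - q) by rewrite expr2 ler_pM; lra.
  by rewrite -(ler_pM2r a0) => /le_trans -> //; lra.
move: (a / _) (Num.sqrt _) c1 c2 c0 mq => c s c1 c2 c0 mq.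
(* Replacing q by m costs at most 2 s, as q < m <= 1; replacing c by 1 costs at most 1/a. *)
have q2 : 0 <= q ^+ 2 <= 1 by rewrite sqr_ge0 exprn_ile1 // ltW.
have qm2 : q ^+ 2 <= m ^+ 2 <= q ^+ 2 + 2 * s by nra.
have : c * q ^+ 2 <= q ^+ 2 by rewrite ler_piMl //; lra.
have : (1 - a^-1) * q ^+ 2 <= c * q ^+ 2 by rewrite ler_wpM2r //; lra.
have : a^-1 * q ^+ 2 <= a^-1 by rewrite ler_piMr //; lra.
by lra.
Unshelve. all: by end_near. Qed.

(** * Efficiency loss in k *)

Lemma psi_lt (R : realType) (k1 k2 g a : R) : 0 < k1 -> 0 < g -> 0 < a ->
  k1 < k2 -> psi k2 g a < psi k1 g a.
Proof.
move=> k10 g0 a0 k12; have k20 := lt_trans k10 k12.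
rewrite !psi_fraction // ltr_pM2r ?invr_gt0 ?inv_risk_gt0 //.
rewrite ltrD2l ltr_pM2l ?divr_gt0 // ltrD2l ltrN2 ltr_pM2l //.
rewrite ltf_pV2 ?posrE ?addr_gt0 ?inv_risk_gt0 //.
by rewrite ltrD2r inv_risk_lt // ltf_pV2 ?posrE ?mulr_gt0 // ltr_pM2r.
Qed.

Lemma psi_cvg_1 (R : realType) (g a : R) : 0 < g -> 0 < a ->
  psi k g a @[k --> 1^'+] --> (1 : R).
Proof.
move=> g0 a0.
(* The limit supplied by [psi_cvg] at u0 = 1/g is [psi 1 g a], that is F / F. *)
rewrite [X in _ --> X](_ : _ =
  (1 + a / g * (1 - a / (inv_risk a g^-1 + a))) / inv_risk a g^-1); last first.
  have := psi_fraction (@ltr01 R) g0 a0; rewrite mul1r => <-.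
  rewrite psi_inv_risk // !mul1r addrC subrK divff // gt_eqF //.
  exact: inv_risk_gt0.
apply: psi_cvg => //.
  near=> k; apply: (lt_trans ltr01); near: k; exact: nbhs_right_gt.
apply: cvg_at_right_filter; rewrite -{2}(mul1r g).
apply: cvgV; first by rewrite mul1r gt_eqF.
by apply: cvgM; [exact: cvg_id|exact: cvg_cst].
Unshelve. all: by end_near. Qed.

(** * Equal distribution as the worst case; closed form of h *)

Lemma ARE_inv_risk (R : realType) (k : nat) (gammas : 'I_k -> R) (g a : R) :
  0 < g -> 0 < a -> (forall i, 0 < gammas i) ->
  ARE gammas g a =
  (1 + \sum_(i < k) (inv_risk a (gammas i)^-1 - 1)) / inv_risk a g^-1.
Proof.
move=> g0 a0 gs0; rewrite /ARE mp_stieltjes_inv_risk //.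
have -> : a / inv_risk a g^-1 / a = (inv_risk a g^-1)^-1.
  by field; rewrite !gt_eqF // inv_risk_gt0.
rewrite mulrC; congr ((1 + _) * _); apply: eq_bigr => i _.
by rewrite mp_stieltjes_inv_risk // invf_div mulrC divfK // gt_eqF.
Qed.

Lemma admissible_equal (R : realType) (k : nat) (g : R) : (1 <= k)%N -> 0 < g ->
  admissible (fun _ : 'I_k => k%:R * g) g.
Proof.
move=> k1 g0; have k0 : 0 < k%:R :> R by rewrite ltr0n.
split=> [i|]; first by rewrite mulr_gt0.
rewrite sumr_const card_ord -mulr_natl.
by field; rewrite !gt_eqF.
Qed.

Lemma ARE_equal_psi (R : realType) (k : nat) (g a : R) :
  (1 <= k)%N -> 0 < g -> 0 < a ->
  ARE (fun _ : 'I_k => k%:R * g) g a = psi k%:R g a.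
Proof.
move=> k1 g0 a0; have k0 : 0 < k%:R :> R by rewrite ltr0n.
rewrite ARE_inv_risk // => [|i]; last exact: mulr_gt0.
by rewrite psi_inv_risk // sumr_const card_ord -[_ *+ k]mulr_natl.
Qed.

Lemma ARE_equal_min (R : realType) (k : nat) (gammas : 'I_k -> R) (g a : R) :
  (1 <= k)%N -> 0 < g -> 0 < a -> admissible gammas g ->
  ARE (fun _ : 'I_k => k%:R * g) g a <= ARE gammas g a.
Proof.
move=> k1 g0 a0 [gs0 gsum]; have [es0 esum] := admissible_equal k1 g0.
rewrite !ARE_inv_risk // ler_pM2r ?invr_gt0 ?inv_risk_gt0 // lerD2l -subr_ge0.
pose f0 := inv_risk a (k%:R * g)^-1.
(* Jensen by tangents at the mean 1/(k g): the linear terms cancel, since both families of inverses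
   sum to 1/g. *)
rewrite -sumrB [leLHS](_ : _ = \sum_(i < k)
    a / (1 + a / f0 ^+ 2) * ((gammas i)^-1 - (k%:R * g)^-1)); last first.
  by rewrite -mulr_sumr sumrB esum gsum subrr mulr0.
apply: ler_sum => i _; clear es0.
by have := inv_risk_tangent (k%:R * g)^-1 (gammas i)^-1 a0; rewrite -/f0; lra.
Qed.

(** The stated root is that of [mp_stieltjes] at z = - g / a, so 1/F is turned back into the
    Stieltjes transform. *)
Lemma h_formula (R : realType) (g a : R) : 0 < g -> 0 < a ->
  h a g =
    (- g / a + g - 1 + Num.sqrt ((- g / a + g - 1) ^+ 2 + 4 * g ^+ 2 / a))
    / (2 * g) * (1 + a / (g * (1 + a))).
Proof.
move=> g0 a0; rewrite /h (cvg_lim _ (psi_cvg_pinfty g0 a0)) //.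
have a1 : 0 < 1 + a by rewrite addr_gt0.
have -> : (inv_risk a g^-1)^-1 = g * mp_stieltjes g (- g / a) / a.
  rewrite mp_stieltjes_inv_risk //.
  by field; rewrite !gt_eqF // inv_risk_gt0.
rewrite /mp_stieltjes.
have -> : (- g / a + g - 1) ^+ 2 - 4 * (- g / a) * g =
    (- g / a + g - 1) ^+ 2 + 4 * g ^+ 2 / a by field; rewrite gt_eqF.
move: (Num.sqrt _) => s.
by field; rewrite !gt_eqF.
Qed.

Theorem theorem4p4 (R : realType) :
  (* 1. Worst case is equally distributed data *)
  (forall (k : nat) (gamma alpha2 : R),
     (1 <= k)%N -> 0 < gamma -> 0 < alpha2 ->
     let equal := fun _ : 'I_k => k%:R * gamma in
     [/\ admissible equal gamma,
         (forall gammas : 'I_k -> R, admissible gammas gamma ->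
            ARE equal gamma alpha2 <= ARE gammas gamma alpha2)
       & ARE equal gamma alpha2 = psi k%:R gamma alpha2])
  /\
  (* 2. Adding more machines leads to efficiency loss *)
  (forall gamma alpha2 : R, 0 < gamma -> 0 < alpha2 ->
     [/\ (forall k1 k2 : R, 1 <= k1 -> k1 < k2 ->
            psi k2 gamma alpha2 < psi k1 gamma alpha2),
         psi k gamma alpha2 @[k --> 1^'+] --> (1 : R),
         psi k gamma alpha2 @[k --> +oo] --> h alpha2 gamma,
         h alpha2 gamma < 1
       & 0 < h alpha2 gamma])
  /\
  (* 3. Form of the infinite-worker limit *)
  (forall gamma alpha2 : R, 0 < gamma -> 0 < alpha2 ->
     h alpha2 gamma =
       (- gamma / alpha2 + gamma - 1
          + Num.sqrt ((- gamma / alpha2 + gamma - 1) ^+ 2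
                      + 4 * gamma ^+ 2 / alpha2)) / (2 * gamma)
       * (1 + alpha2 / (gamma * (1 + alpha2))))
  /\
  (* 4. Edge cases *)
  (forall alpha2 : R, 0 < alpha2 ->
     [/\ (forall g1 g2 : R, 0 <= g1 -> g1 < g2 ->
            h_of_gamma alpha2 g1 < h_of_gamma alpha2 g2),
         h alpha2 gamma @[gamma --> 0^'+] --> 1 / (1 + alpha2)
       & h alpha2 gamma @[gamma --> +oo] --> (1 : R)])
  /\
  (forall gamma : R, 0 < gamma ->
     [/\ (forall a1 a2 : R, 0 <= a1 -> a1 < a2 ->
            h_of_alpha2 gamma a2 < h_of_alpha2 gamma a1),
         h alpha2 gamma @[alpha2 --> 0^'+] --> (1 : R)
       & h alpha2 gamma @[alpha2 --> +oo] -->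
           (if 1 < gamma then 1 - 1 / gamma ^+ 2 else 0)]).
Proof.
split; last split; last split; last split.
- move=> k g a k1 g0 a0 /=; split.
  + exact: admissible_equal.
  + by move=> gammas; apply: ARE_equal_min.
  + exact: ARE_equal_psi.
- move=> g a g0 a0; split.
  + by move=> k1 k2 k1_ge1; apply: psi_lt => //; apply: lt_le_trans k1_ge1.
  + exact: psi_cvg_1.
  + by rewrite /h (cvg_lim _ (psi_cvg_pinfty g0 a0)) //; apply: psi_cvg_pinfty.
  + exact: h_lt1.
  + apply: lt_trans (h_gt_endpoint g0 a0).
    by rewrite divr_gt0 // addr_gt0.
- exact: h_formula.
- move=> a a0; split.
  + move=> g1 g2 g10 g12; have g20 : 0 < g2 by exact: le_lt_trans g12.
    rewrite /h_of_gamma (gt_eqF g20).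
    (* At g1 = 0 the value is the limit 1 / (1 + a), strictly below h at g2. *)
    case: eqP => [_|/eqP g1_neq0].
      by rewrite (cvg_lim _ (h_cvg_gamma0 a0)) // h_gt_endpoint.
    by apply: h_lt_gamma => //; rewrite lt0r g1_neq0.
  + exact: h_cvg_gamma0.
  + exact: h_cvg_gamma_pinfty.
- move=> g g0; split.
  + move=> a1 a2 a10 a12; have a20 : 0 < a2 by exact: le_lt_trans a12.
    rewrite /h_of_alpha2 (gt_eqF a20).
    case: eqP => [_|/eqP a1_neq0].
      by rewrite (cvg_lim _ (h_cvg_alpha20 g0)) // h_lt1.
    by apply: h_lt_alpha2 => //; rewrite lt0r a1_neq0.
  + exact: h_cvg_alpha20.
  + have := h_cvg_alpha2_pinfty g0; case: ltP => g1.
      by rewrite min_l ?exprVn ?div1r // invf_le1 // ltW.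
    by rewrite min_r ?expr1n ?subrr // invf_ge1.
Qed.
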